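(* Let $A$ be a sequence algebra and let $X\in\mathcal H$. Then $X$ is extremely projective with respect to $\mathcal H$ if and only if both of the following hold: (i) for every $n\in\mathbb N$, the coordinate subspace $X_n$ is extremely projective in $\mathbf{Nor}$ (equivalently, $X_n$ is a near-retract in $\mathbf{Nor}$ of $l_1^0(\Lambda_n)$ for some index set $\Lambda_n$); (ii) $X$ is of finite type. Moreover, if $X\in\mathcal H$ is merely topologically projective with respect to $\mathcal H$, then $X$ is of finite type.
   Context: All normed algebras and modules are contractive: $\|ab\|\le\|a\|\|b\|$ and $\|a\cdot x\|\le\|a\|\|x\|$; modules are left normed $A$-modules, not necessarily complete, and morphisms are bounded $A$-module maps. A morphism $\tau:Y\to X$ is coisometric if $\|\tau\|\le1$ and for every $x\in X$, $\varepsilon>0$ there is $y\in Y$ with $\tau(y)=x$, $\|y\|<\|x\|+\varepsilon$. Given a surjective $\tau:Y\to X$ and $\varphi:P\to X$, a lifting of $\varphi$ with respect to $\tau$ is a morphism $\psi:P\to Y$ with $\tau\psi=\varphi$. For a full subcategory $\mathcal K$ of the category of normed $A$-modules, a normed $A$-module $P$ is extremely projective with respect to $\mathcal K$ if for every coisometric morphism $\tau:Y\to X$ with $X,Y\in\mathcal K$, every bounded morphism $\varphi:P\to X$ and every $\varepsilon>0$ there is a lifting $\psi$ of $\varphi$ with respect to $\tau$ with $\|\psi\|<\|\varphi\|+\varepsilon$; $P$ is topologically projective with respect to $\mathcal K$ if every such $\varphi$ has a bounded lifting. A contractive morphism $\sigma:Y\to X$ is a near-retraction if for every $\varepsilon>0$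 it has a right inverse morphism $\rho$ ($\sigma\rho=1_X$) with $\|\rho\|<1+\varepsilon$; $X$ is a near-retract of $Y$ if such $\sigma$ exists. A normed space is extremely projective in $\mathbf{Nor}$ if it is extremely projective with respect to the category of all normed spaces (modules over $\mathbb C$). For a set $\Lambda$, $l_1^0(\Lambda)$ is the space of finitely supported functions on $\Lambda$ with the $l_1$-norm ($l_1^0(\emptyset)=0$). A sequence algebra is a normed algebra of complex sequences with coordinatewise operations that contains $c_{00}$ (finite sequences) as a dense subalgebra and with $\|\mathbf p^n\|=1$ for all $n$, where $\mathbf p^n$ is the sequence with $1$ in place $n$ and $0$ elsewhere. For an $A$-module $X$ and $x\in X$, write $x_n:=\mathbf p^n\cdot x$ and $X_n:=\{\mathbf p^n\cdot x: x\in X\}$ (the $n$-th coordinate subspace/submodule). $X$ is essential if the closed linear span of $\{a\cdot x\}$ is $X$; homogeneous if for $x,y\in X$, $\|x_n\|\le\|y_n\|$ for all $n$ implies $\|x\|\le\|y\|$; of finite type if for every $x\in X$, $x_n=0$ for all sufficiently large $n$. $\mathcal H$ is the full subcategory of essential homogeneous normed $A$-modules. *)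

(* Defs.v *)
From Stdlib Require Import Reals Lra Lia List ProofIrrelevance.
Open Scope R_scope.

Definition C : Type := (R * R)%type.
Definition C0 : C := (0, 0).
Definition C1 : C := (1, 0).
Definition Cadd (z w : C) : C := (fst z + fst w, snd z + snd w).
Definition Cmul (z w : C) : C :=
  (fst z * fst w - snd z * snd w, fst z * snd w + snd z * fst w).
Definition Cabs (z : C) : R := sqrt (fst z ^ 2 + snd z ^ 2).

Record NormedSpace := {
  ns_car :> Type;
  ns_zero : ns_car;
  ns_add : ns_car -> ns_car -> ns_car;
  ns_opp : ns_car -> ns_car;
  ns_scal : C -> ns_car -> ns_car;
  ns_norm : ns_car -> R;
  ns_addA : forall x y z, ns_add x (ns_add y z) = ns_add (ns_add x y) z;
  ns_addC : forall x y, ns_add x y = ns_add y x;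
  ns_add0 : forall x, ns_add x ns_zero = x;
  ns_addN : forall x, ns_add x (ns_opp x) = ns_zero;
  ns_scal1 : forall x, ns_scal C1 x = x;
  ns_scalA : forall c d x, ns_scal c (ns_scal d x) = ns_scal (Cmul c d) x;
  ns_scalDr : forall c x y, ns_scal c (ns_add x y) = ns_add (ns_scal c x) (ns_scal c y);
  ns_scalDl : forall c d x, ns_scal (Cadd c d) x = ns_add (ns_scal c x) (ns_scal d x);
  ns_norm_ge0 : forall x, 0 <= ns_norm x;
  ns_norm_eq0 : forall x, ns_norm x = 0 -> x = ns_zero;
  ns_norm_tri : forall x y, ns_norm (ns_add x y) <= ns_norm x + ns_norm y;
  ns_normZ : forall c x, ns_norm (ns_scal c x) = Cabs c * ns_norm x
}.
Arguments ns_zero {_}.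
Arguments ns_add {_} _ _.
Arguments ns_opp {_} _.
Arguments ns_scal {_} _ _.
Arguments ns_norm {_} _.

Definition is_linear {V W : NormedSpace} (f : V -> W) : Prop :=
  (forall x y, f (ns_add x y) = ns_add (f x) (f y)) /\
  (forall c x, f (ns_scal c x) = ns_scal c (f x)).

Definition bounded_by {V W : NormedSpace} (f : V -> W) (M : R) : Prop :=
  0 <= M /\ forall x, ns_norm (f x) <= M * ns_norm x.

Definition is_bounded {V W : NormedSpace} (f : V -> W) : Prop :=
  exists M, bounded_by f M.

Definition is_opnorm {V W : NormedSpace} (f : V -> W) (r : R) : Prop :=
  bounded_by f r /\ forall M, bounded_by f M -> r <= M.

Definition coisometric {V W : NormedSpace} (tau : V -> W) : Prop :=
  bounded_by tau 1 /\
  forall (x : W) (eps : R), 0 < eps ->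
    exists y : V, tau y = x /\ ns_norm y < ns_norm x + eps.

Definition ext_proj_Nor (P : NormedSpace) : Prop :=
  forall (X Y : NormedSpace) (tau : Y -> X) (phi : P -> X) (r eps : R),
    is_linear tau -> coisometric tau ->
    is_linear phi -> is_opnorm phi r -> 0 < eps ->
    exists psi : P -> Y,
      is_linear psi /\ (forall p, tau (psi p) = phi p) /\
      exists r', is_opnorm psi r' /\ r' < r + eps.

Definition cseq := nat -> C.
Definition szero : cseq := fun _ => C0.
Definition sadd (a b : cseq) : cseq := fun n => Cadd (a n) (b n).
Definition sscal (c : C) (a : cseq) : cseq := fun n => Cmul c (a n).
Definition sopp (a : cseq) : cseq := sscal (- 1, 0) a.
Definition smul (a b : cseq) : cseq := fun n => Cmul (a n) (b n).
Definition pn (n : nat) : cseq := fun k => if Nat.eqb k n then C1 else C0.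
Definition finsupp (a : cseq) : Prop :=
  exists N, forall k, (N <= k)%nat -> a k = C0.

(** A normed algebra of sequences with coordinatewise operations, containing
    c_00 as a dense subalgebra, contractive norm, ||p^n|| = 1. The algebra is
    the set of sequences satisfying [sa_mem]; [sa_norm] is only meaningful on it. *)
Record SeqAlg := {
  sa_mem : cseq -> Prop;
  sa_norm : cseq -> R;
  sa_mem_c00 : forall a, finsupp a -> sa_mem a;
  sa_mem_add : forall a b, sa_mem a -> sa_mem b -> sa_mem (sadd a b);
  sa_mem_scal : forall c a, sa_mem a -> sa_mem (sscal c a);
  sa_mem_mul : forall a b, sa_mem a -> sa_mem b -> sa_mem (smul a b);
  sa_norm_ge0 : forall a, sa_mem a -> 0 <= sa_norm a;
  sa_norm_eq0 : forall a, sa_mem a -> sa_norm a = 0 -> a = szero;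
  sa_norm_tri : forall a b, sa_mem a -> sa_mem b ->
      sa_norm (sadd a b) <= sa_norm a + sa_norm b;
  sa_normZ : forall c a, sa_mem a -> sa_norm (sscal c a) = Cabs c * sa_norm a;
  sa_norm_mul : forall a b, sa_mem a -> sa_mem b ->
      sa_norm (smul a b) <= sa_norm a * sa_norm b;
  sa_dense : forall a, sa_mem a -> forall eps, 0 < eps ->
      exists b, finsupp b /\ sa_norm (sadd a (sopp b)) < eps;
  sa_norm_pn : forall n, sa_norm (pn n) = 1
}.

Record Module (A : SeqAlg) := {
  md_sp :> NormedSpace;
  md_act : cseq -> md_sp -> md_sp;
  md_act_add : forall a x y, sa_mem A a ->
      md_act a (ns_add x y) = ns_add (md_act a x) (md_act a y);
  md_act_scal : forall a c x, sa_mem A a ->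
      md_act a (ns_scal c x) = ns_scal c (md_act a x);
  (* the next two are consequences of the previous ones, stated for convenience *)
  md_act_zero : forall a, sa_mem A a -> md_act a ns_zero = ns_zero;
  md_act_opp : forall a x, sa_mem A a -> md_act a (ns_opp x) = ns_opp (md_act a x);
  md_act_addl : forall a b x, sa_mem A a -> sa_mem A b ->
      md_act (sadd a b) x = ns_add (md_act a x) (md_act b x);
  md_act_scall : forall c a x, sa_mem A a ->
      md_act (sscal c a) x = ns_scal c (md_act a x);
  md_act_mul : forall a b x, sa_mem A a -> sa_mem A b ->
      md_act (smul a b) x = md_act a (md_act b x);
  md_act_norm : forall a x, sa_mem A a ->
      ns_norm (md_act a x) <= sa_norm A a * ns_norm x
}.
Arguments md_sp {A}.
Arguments md_act {A} _ _ _.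

Definition is_morphism {A : SeqAlg} {X Y : Module A} (f : X -> Y) : Prop :=
  is_linear f /\
  (forall a x, sa_mem A a -> f (md_act X a x) = md_act Y a (f x)) /\
  is_bounded f.

Definition ext_proj_wrt {A : SeqAlg} (K : Module A -> Prop) (P : Module A) : Prop :=
  forall (X Y : Module A) (tau : Y -> X) (phi : P -> X) (r eps : R),
    K X -> K Y ->
    is_morphism tau -> coisometric tau ->
    is_morphism phi -> is_opnorm phi r -> 0 < eps ->
    exists psi : P -> Y,
      is_morphism psi /\ (forall p, tau (psi p) = phi p) /\
      exists r', is_opnorm psi r' /\ r' < r + eps.

Definition top_proj_wrt {A : SeqAlg} (K : Module A -> Prop) (P : Module A) : Prop :=
  forall (X Y : Module A) (tau : Y -> X) (phi : P -> X),
    K X -> K Y ->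
    is_morphism tau -> coisometric tau -> is_morphism phi ->
    exists psi : P -> Y,
      is_morphism psi /\ (forall p, tau (psi p) = phi p).

Definition lin_comb {A : SeqAlg} (X : Module A) (l : list (C * cseq * X)) : X :=
  fold_right (fun t s => ns_add (ns_scal (fst (fst t)) (md_act X (snd (fst t)) (snd t))) s)
             ns_zero l.

Definition essential {A : SeqAlg} (X : Module A) : Prop :=
  forall (x : X) (eps : R), 0 < eps ->
    exists l : list (C * cseq * X),
      Forall (fun t => sa_mem A (snd (fst t))) l /\
      ns_norm (ns_add x (ns_opp (lin_comb X l))) < eps.

Definition homogeneous {A : SeqAlg} (X : Module A) : Prop :=
  forall x y : X,
    (forall n, ns_norm (md_act X (pn n) x) <= ns_norm (md_act X (pn n) y)) ->
    ns_norm x <= ns_norm y.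

Definition finite_type {A : SeqAlg} (X : Module A) : Prop :=
  forall x : X, exists N, forall n, (N <= n)%nat -> md_act X (pn n) x = ns_zero.

Definition in_H {A : SeqAlg} (X : Module A) : Prop := essential X /\ homogeneous X.

Lemma sub_eq {V : NormedSpace} {P : V -> Prop} (u v : {x : V | P x}) :
  proj1_sig u = proj1_sig v -> u = v.
Proof.
  destruct u as [u hu], v as [v hv]; simpl; intros ->.
  f_equal; apply proof_irrelevance.
Qed.

Definition subspace (V : NormedSpace) (P : V -> Prop)
  (P0 : P ns_zero)
  (Padd : forall x y, P x -> P y -> P (ns_add x y))
  (Popp : forall x, P x -> P (ns_opp x))
  (Pscal : forall c x, P x -> P (ns_scal c x)) : NormedSpace.
Proof.
  refine {| ns_car := {x : V | P x};
            ns_zero := exist _ ns_zero P0;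
            ns_add := fun u v => exist _ (ns_add (proj1_sig u) (proj1_sig v))
                                   (Padd _ _ (proj2_sig u) (proj2_sig v));
            ns_opp := fun u => exist _ (ns_opp (proj1_sig u)) (Popp _ (proj2_sig u));
            ns_scal := fun c u => exist _ (ns_scal c (proj1_sig u)) (Pscal c _ (proj2_sig u));
            ns_norm := fun u => ns_norm (proj1_sig u) |};
  intros; try (apply sub_eq; simpl).
  - apply ns_addA.
  - apply ns_addC.
  - apply ns_add0.
  - apply ns_addN.
  - apply ns_scal1.
  - apply ns_scalA.
  - apply ns_scalDr.
  - apply ns_scalDl.
  - apply ns_norm_ge0.
  - apply ns_norm_eq0; assumption.
  - apply ns_norm_tri.
  - apply ns_normZ.
Defined.

Lemma pn_mem (A : SeqAlg) (n : nat) : sa_mem A (pn n).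
Proof.
  apply sa_mem_c00. exists (S n). intros k Hk. unfold pn.
  destruct (Nat.eqb k n) eqn:E; [apply Nat.eqb_eq in E; lia | reflexivity].
Qed.

Definition coord_space {A : SeqAlg} (X : Module A) (n : nat) : NormedSpace.
Proof.
  refine (subspace X (fun x => exists y, x = md_act X (pn n) y) _ _ _ _).
  - exists ns_zero. symmetry. apply md_act_zero, pn_mem.
  - intros x y [x' ->] [y' ->]. exists (ns_add x' y'). symmetry.
    apply md_act_add, pn_mem.
  - intros x [x' ->]. exists (ns_opp x'). symmetry. apply md_act_opp, pn_mem.
  - intros c x [x' ->]. exists (ns_scal c x'). symmetry. apply md_act_scal, pn_mem.
Defined.

(* Main.v *)
(** In a homogeneous module the norm depends only on the norms of the coordinates.
    If X is of finite type with projective coordinates, lift phi coordinatewise to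
    psi_n with |psi_n| <= (1 + delta) |phi_n|. The possibly large coordinates
    psi_n (x_n) are compared not with phi (x) but with phi (z), where z_n is an almost
    norm-attaining vector of phi_n with |z_n| <= |x_n|.

    Conversely, any normed space placed in the n-th coordinate is a module in H, which
    makes X_n projective. For finite type, map x to the null sequence (x_n) in c_0(X).
    This space is a coisometric image of the space of families f (n, k) with
    f (n, k) = (k + 1) f (n, 0) for each k and all n large depending on k, tending to 0
    in n uniformly in k, with the sup norm, under f |-> f (., 0): x is lifted
    by (k + 1) x_n for k <= w_n and 0 for k > w_n, with weights w_n tending slowly to
    infinity. A lifting psi bounded by M satisfies
    (k + 1) |x_n| = |psi (x) (n, k)| <= |psi (x_n)| <= M |x_n| for n large, hence x_n = 0
    as soon as k + 1 > M. *)

From Stdlib Require Import Reals Lra Lia Arith List Classical ClassicalEpsilon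
  FunctionalExtensionality.
Require Import Defs.

Local Notation "x +v y" := (ns_add x y) (at level 50, left associativity).
Local Notation "-v x" := (ns_opp x) (at level 35, right associativity).
Local Notation "c *v x" := (ns_scal c x) (at level 40, no associativity).
Local Notation "a @v x" := (md_act _ a x) (at level 40, no associativity).
Local Notation norm := ns_norm.

(** * Choice and a limiting inequality *)

Lemma choice_fun {T U : Type} (P : T -> U -> Prop) :
  (forall x, exists y, P x y) -> exists f : T -> U, forall x, P x (f x).
Proof.
  intros H.
  exists (fun x => proj1_sig (constructive_indefinite_description _ (H x))).
  intros x. exact (proj2_sig (constructive_indefinite_description _ (H x))).
Qed.

Lemma le_of_factor_limit (a b c : R) :
  (forall eta, 0 < eta < 1 -> a * (1 - eta) <= b + c * eta) -> a <= b.
Proof.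
  intros H. destruct (Rle_dec a b) as [|Hab]; [assumption|exfalso].
  (* If a > b, the hypothesis bounds a - b by (a + c) eta. Since [s] is at least a + c, the [eta]
     below makes this at most (a - b) / 2. *)
  set (s := Rabs a + Rabs c + (a - b)).
  assert (Ha := Rle_abs a). assert (Hc := Rle_abs c).
  assert (Ha0 := Rabs_pos a). assert (Hc0 := Rabs_pos c).
  assert (Hs : 0 < s) by (unfold s; lra).
  set (eta := (a - b) / (2 * s)).
  assert (E : eta * (2 * s) = a - b) by (unfold eta; field; lra).
  assert (He : 0 < eta) by (unfold eta; apply Rdiv_lt_0_compat; lra).
  assert (He1 : eta < 1) by (unfold s in *; nra).
  specialize (H eta (conj He He1)). unfold s in E. nra.
Qed.

(** * Complex scalars *)

Lemma Cmul_comm (c d : C) : Cmul c d = Cmul d c.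
Proof. unfold Cmul. f_equal; ring. Qed.

Lemma Cmul_0l (c : C) : Cmul C0 c = C0.
Proof. destruct c; unfold Cmul, C0; simpl. f_equal; ring. Qed.

Lemma Cmul_0r (c : C) : Cmul c C0 = C0.
Proof. rewrite Cmul_comm. apply Cmul_0l. Qed.

Lemma Cabs_real (t : R) : Cabs (t, 0) = Rabs t.
Proof.
  unfold Cabs; simpl. replace (t * (t * 1) + 0 * (0 * 1)) with (Rsqr t)
    by (unfold Rsqr; ring). apply sqrt_Rsqr_abs.
Qed.

Lemma Cabs_C0 : Cabs C0 = 0.
Proof. unfold C0. rewrite Cabs_real. apply Rabs_R0. Qed.

Lemma Cabs_ge0 (c : C) : 0 <= Cabs c.
Proof. apply sqrt_pos. Qed.

(** * Normed spaces *)

Lemma scal0 {V : NormedSpace} (x : V) : C0 *v x = ns_zero.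
Proof. apply ns_norm_eq0. rewrite ns_normZ, Cabs_C0. ring. Qed.

Lemma norm0 {V : NormedSpace} : norm (@ns_zero V) = 0.
Proof. rewrite <- (scal0 ns_zero), ns_normZ, Cabs_C0. ring. Qed.

Lemma scal_zero {V : NormedSpace} (c : C) : c *v (@ns_zero V) = ns_zero.
Proof. apply ns_norm_eq0. rewrite ns_normZ, norm0. ring. Qed.

Lemma add0l {V : NormedSpace} (x : V) : ns_zero +v x = x.
Proof. rewrite ns_addC. apply ns_add0. Qed.

Lemma addNl {V : NormedSpace} (x : V) : -v x +v x = ns_zero.
Proof. rewrite ns_addC. apply ns_addN. Qed.

Lemma addK {V : NormedSpace} (x y : V) : x +v y +v -v y = x.
Proof. rewrite <- ns_addA, ns_addN. apply ns_add0. Qed.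

Lemma addNK {V : NormedSpace} (x y : V) : x +v -v y +v y = x.
Proof. rewrite <- ns_addA, addNl. apply ns_add0. Qed.

Lemma opp_eq {V : NormedSpace} (x y : V) : x +v y = ns_zero -> y = -v x.
Proof. intros H. rewrite <- (addK y x), (ns_addC _ y x), H. apply add0l. Qed.

Lemma opp_scal {V : NormedSpace} (x : V) : -v x = (-1, 0) *v x.
Proof.
  symmetry. apply opp_eq. rewrite <- (ns_scal1 V x) at 1.
  rewrite <- ns_scalDl, <- (scal0 x). f_equal.
  unfold Cadd, C1, C0; simpl. f_equal; ring.
Qed.

Lemma sub_eq0 {V : NormedSpace} (x y : V) : x +v -v y = ns_zero -> x = y.
Proof. intros H. rewrite <- (addNK x y), H. apply add0l. Qed.

Lemma scal_comm {V : NormedSpace} (c d : C) (x : V) : c *v (d *v x) = d *v (c *v x).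
Proof. now rewrite !ns_scalA, Cmul_comm. Qed.

Lemma linear_zero {V W : NormedSpace} (f : V -> W) : is_linear f -> f ns_zero = ns_zero.
Proof. intros [_ H]. rewrite <- (scal0 ns_zero), H. apply scal0. Qed.

(** The infimum of all bounds is itself a bound, which gives the least one. *)
Lemma opnorm_exists {V W : NormedSpace} (f : V -> W) (M : R) :
  bounded_by f M -> exists r, is_opnorm f r /\ r <= M.
Proof.
  (* Bounds are negated because completeness provides suprema; the operator norm is then [- m]. *)
  intros HM. set (E := fun t => bounded_by f (- t)).
  destruct (completeness E) as [m [Hub Hleast]].
  - exists 0. intros t [Ht _]. lra.
  - exists (- M). unfold E. now rewrite Ropp_involutive.
  - assert (Hm : m <= 0) by (apply Hleast; intros t [Ht _]; lra).
    assert (HmM : - m <= M).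
    { assert (HE : E (- M)) by (unfold E; now rewrite Ropp_involutive).
      apply Hub in HE. lra. }
    exists (- m). split; [split; [split; [lra|]|]|exact HmM].
    + intros x. destruct (Rle_dec (norm (f x)) (- m * norm x)) as [|Hx]; [assumption|].
      exfalso. apply Rnot_le_lt in Hx.
      destruct HM as [HM0 HM]. specialize (HM x).
      destruct (ns_norm_ge0 V x) as [Hp|Hz]; [|rewrite <- Hz in *; lra].
      assert (m <= - (norm (f x) / norm x)).
      { apply Hleast. intros t [_ Ht]. specialize (Ht x).
        apply Ropp_le_cancel. rewrite Ropp_involutive.
        apply Rmult_le_reg_r with (norm x); [exact Hp|].
        unfold Rdiv. rewrite Rmult_assoc, Rinv_l, Rmult_1_r; lra. }
      assert (norm (f x) / norm x * norm x = norm (f x)) by (field; lra).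
      nra.
    + intros M' HM'. assert (HE : E (- M')) by (unfold E; now rewrite Ropp_involutive).
      apply Hub in HE. lra.
Qed.

(** * Coordinates in modules over a sequence algebra *)

Lemma pn_same (n : nat) : pn n n = C1.
Proof. unfold pn. now rewrite Nat.eqb_refl. Qed.

Lemma pn_other (n k : nat) : k <> n -> pn n k = C0.
Proof. intros H. unfold pn. now apply Nat.eqb_neq in H as ->. Qed.

Lemma smul_comm (a b : cseq) : smul a b = smul b a.
Proof. apply functional_extensionality; intros k. apply Cmul_comm. Qed.

Lemma smul_pn (a : cseq) (n : nat) : smul a (pn n) = sscal (a n) (pn n).
Proof.
  apply functional_extensionality; intros k. unfold smul, sscal.
  destruct (Nat.eq_dec k n) as [->|H]; [reflexivity|].
  now rewrite pn_other, !Cmul_0r.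
Qed.

(** Since a p^n = a_n p^n and p^n has norm 1, submultiplicativity gives the bound. *)
Lemma Cabs_coord_le (A : SeqAlg) (a : cseq) (n : nat) :
  sa_mem A a -> Cabs (a n) <= sa_norm A a.
Proof.
  intros Ha. assert (H := sa_norm_mul A a (pn n) Ha (pn_mem A n)).
  rewrite smul_pn, sa_normZ, sa_norm_pn in H by apply pn_mem. lra.
Qed.

(** Finite sequences are dense and coordinates are contractive, so the algebra lies in c_0. *)
Lemma alg_coord_vanish (A : SeqAlg) (a : cseq) (eps : R) :
  sa_mem A a -> 0 < eps -> exists N, forall n, (N <= n)%nat -> Cabs (a n) <= eps.
Proof.
  intros Ha He. destruct (sa_dense A a Ha eps He) as [b [[N Hb] Hab]].
  exists N. intros n Hn.
  assert (Hm : sa_mem A (sadd a (sopp b))).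
  { apply sa_mem_add, sa_mem_scal, sa_mem_c00; [assumption|now exists N]. }
  apply (Cabs_coord_le A _ n) in Hm.
  replace (sadd a (sopp b) n) with (a n) in Hm; [lra|].
  unfold sadd, sopp, sscal. rewrite (Hb n Hn), Cmul_0r.
  destruct (a n); unfold Cadd, C0; simpl; f_equal; ring.
Qed.

Section Coordinates.
Context {A : SeqAlg}.

Lemma act_coord (X : Module A) (a : cseq) (n : nat) (x : X) :
  sa_mem A a -> a @v (pn n @v x) = a n *v (pn n @v x).
Proof.
  intros Ha. rewrite <- md_act_mul by (assumption || apply pn_mem). rewrite smul_pn.
  apply md_act_scall, pn_mem.
Qed.

Lemma coord_act (X : Module A) (a : cseq) (n : nat) (x : X) :
  sa_mem A a -> pn n @v (a @v x) = a n *v (pn n @v x).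
Proof.
  intros Ha. rewrite <- md_act_mul by (assumption || apply pn_mem). rewrite smul_comm, smul_pn.
  apply md_act_scall, pn_mem.
Qed.

Lemma coord_same (X : Module A) (n : nat) (x : X) : pn n @v (pn n @v x) = pn n @v x.
Proof. rewrite act_coord, pn_same by apply pn_mem. apply ns_scal1. Qed.

Lemma coord_other (X : Module A) (n m : nat) (x : X) :
  n <> m -> pn n @v (pn m @v x) = ns_zero.
Proof. intros H. rewrite act_coord, pn_other by (congruence || apply pn_mem). apply scal0. Qed.

Lemma norm_coord_le (X : Module A) (n : nat) (x : X) : norm (pn n @v x) <= norm x.
Proof.
  assert (H := md_act_norm A X (pn n) x (pn_mem A n)). rewrite sa_norm_pn in H. lra.
Qed.

Lemma coord_add (X : Module A) (n : nat) (x y : X) :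
  pn n @v (x +v y) = pn n @v x +v pn n @v y.
Proof. apply md_act_add, pn_mem. Qed.

Lemma coord_scal (X : Module A) (n : nat) (c : C) (x : X) :
  pn n @v (c *v x) = c *v (pn n @v x).
Proof. apply md_act_scal, pn_mem. Qed.

Lemma coord_zero (X : Module A) (n : nat) : pn n @v (@ns_zero X) = ns_zero.
Proof. apply md_act_zero, pn_mem. Qed.

(** Homogeneity compares x - y, all of whose coordinates vanish, with 0. *)
Lemma homogeneous_ext (X : Module A) (x y : X) :
  homogeneous X -> (forall n, pn n @v x = pn n @v y) -> x = y.
Proof.
  intros HX H. apply sub_eq0, ns_norm_eq0, Rle_antisym; [|apply ns_norm_ge0].
  rewrite <- (@norm0 X). apply HX. intros n.
  rewrite coord_add, md_act_opp, H, ns_addN, coord_zero by apply pn_mem. apply Rle_refl.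
Qed.

(** * Null coordinates in essential modules, and gluing of finitely many coordinates *)

Definition vanishing (X : Module A) (x : X) : Prop :=
  forall eps, 0 < eps -> exists N, forall n, (N <= n)%nat -> norm (pn n @v x) <= eps.

Lemma vanishing_add (X : Module A) (x y : X) :
  vanishing X x -> vanishing X y -> vanishing X (x +v y).
Proof.
  intros Hx Hy eps He.
  destruct (Hx (eps / 2)) as [N HN]; [lra|]. destruct (Hy (eps / 2)) as [M HM]; [lra|].
  exists (N + M)%nat. intros n Hn. rewrite coord_add.
  specialize (HN n ltac:(lia)). specialize (HM n ltac:(lia)).
  assert (H := ns_norm_tri X (pn n @v x) (pn n @v y)). lra.
Qed.

(** The decay comes from the coefficients a_n; the coordinates of [x] are merely bounded by its
    norm. *)
Lemma vanishing_scal_act (X : Module A) (c : C) (a : cseq) (x : X) :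
  sa_mem A a -> vanishing X (c *v (a @v x)).
Proof.
  intros Ha eps He.
  assert (Hc := Cabs_ge0 c). assert (Hx := ns_norm_ge0 X x).
  set (s := Cabs c * norm x + 1). assert (Hs : 0 < s) by (unfold s; nra).
  destruct (alg_coord_vanish A a (eps / s) Ha) as [N HN].
  { apply Rdiv_lt_0_compat; assumption. }
  exists N. intros n Hn. specialize (HN n Hn).
  rewrite coord_scal, coord_act, !ns_normZ by assumption.
  assert (H1 := norm_coord_le X n x). assert (H0 := ns_norm_ge0 X (pn n @v x)).
  assert (Ha0 := Cabs_ge0 (a n)).
  assert (E : eps / s * s = eps) by (field; lra).
  assert (H2 : Cabs (a n) * norm (pn n @v x) <= eps / s * norm x)
    by (apply Rmult_le_compat; assumption).
  assert (H3 : 0 < eps / s) by (apply Rdiv_lt_0_compat; assumption).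
  apply Rle_trans with (Cabs c * (eps / s * norm x));
    [now apply Rmult_le_compat_l|].
  unfold s in *. nra.
Qed.

(** Each term of a linear combination has null coordinates, and contractivity of the coordinate
    projections carries this to norm limits. *)
Lemma essential_vanishing (X : Module A) : essential X -> forall x, vanishing X x.
Proof.
  intros HX x eps He. destruct (HX x (eps / 2)) as [l [Hl Hx]]; [lra|].
  assert (Hv : vanishing X (lin_comb X l)).
  { clear Hx. induction Hl as [|t l Ht Hl IH].
    - intros e Hpos. exists 0%nat. intros n _.
      change (norm (pn n @v (@ns_zero X)) <= e). rewrite coord_zero, norm0. lra.
    - apply vanishing_add; [now apply vanishing_scal_act|exact IH]. }
  destruct (Hv (eps / 2)) as [N HN]; [lra|].
  exists N. intros n Hn. specialize (HN n Hn).
  rewrite <- (addNK x (lin_comb X l)), coord_add.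
  assert (H1 := norm_coord_le X n (x +v -v lin_comb X l)).
  assert (H2 := ns_norm_tri X (pn n @v (x +v -v lin_comb X l)) (pn n @v lin_comb X l)).
  lra.
Qed.

(** The element is the finite sum of the f n with n < N, built by splitting off the last term. *)
Lemma glue_coords (X : Module A) (f : nat -> X) (N : nat) :
  (forall n, pn n @v f n = f n) -> (forall n, (N <= n)%nat -> f n = ns_zero) ->
  exists x, forall n, pn n @v x = f n.
Proof.
  revert f. induction N as [|N IH]; intros f Hf HN.
  - exists ns_zero. intros n. rewrite coord_zero. symmetry. apply HN. lia.
  - destruct (IH (fun n => if Nat.eqb n N then ns_zero else f n)) as [x Hx].
    + intros n. destruct (Nat.eqb n N); [apply coord_zero|apply Hf].
    + intros n Hn. destruct (Nat.eqb_spec n N); [reflexivity|]. apply HN. lia.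
    + exists (x +v f N). intros n. rewrite coord_add, Hx.
      destruct (Nat.eqb_spec n N) as [->|Hn]; [now rewrite Hf, add0l|].
      rewrite <- (Hf N), coord_other by assumption. apply ns_add0.
Qed.

(** * Coordinate subspaces and the maps induced on them *)

Definition coord_in (X : Module A) (n : nat) (x : X) : coord_space X n :=
  exist _ (pn n @v x) (ex_intro _ x eq_refl).

Definition coord_val {X : Module A} {n : nat} (u : coord_space X n) : X := proj1_sig u.

Lemma coord_val_inj {X : Module A} {n : nat} (u v : coord_space X n) :
  coord_val u = coord_val v -> u = v.
Proof. exact (sub_eq u v). Qed.

Lemma norm_coord_val {X : Module A} {n : nat} (u : coord_space X n) :
  norm (coord_val u) = norm u.
Proof. reflexivity. Qed.

Lemma coord_in_linear (X : Module A) (n : nat) : is_linear (coord_in X n).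
Proof. split; intros; apply coord_val_inj; [apply coord_add|apply coord_scal]. Qed.

Lemma coord_val_fixed {X : Module A} {n : nat} (u : coord_space X n) :
  pn n @v coord_val u = coord_val u.
Proof. destruct u as [u [x ->]]. apply coord_same. Qed.

Lemma coord_in_val {X : Module A} {n : nat} (u : coord_space X n) :
  coord_in X n (coord_val u) = u.
Proof. apply coord_val_inj, coord_val_fixed. Qed.

Lemma morphism_coord {X Y : Module A} (f : X -> Y) (n : nat) (x : X) :
  is_morphism f -> pn n @v f x = f (pn n @v x).
Proof. intros [_ [Hf _]]. symmetry. apply Hf, pn_mem. Qed.

(** For a morphism this is the restriction to the n-th coordinates; projecting the value makes it
    well typed for any function. *)
Definition coord_map {X Y : Module A} (f : X -> Y) (n : nat)
  (u : coord_space X n) : coord_space Y n := coord_in Y n (f (coord_val u)).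

Lemma coord_map_val {X Y : Module A} (f : X -> Y) (n : nat) (u : coord_space X n) :
  is_morphism f -> coord_val (coord_map f n u) = f (coord_val u).
Proof.
  intros Hf. change (pn n @v f (coord_val u) = f (coord_val u)).
  now rewrite morphism_coord, coord_val_fixed.
Qed.

Lemma coord_map_linear {X Y : Module A} (f : X -> Y) (n : nat) :
  is_linear f -> is_linear (coord_map f n).
Proof.
  destruct (coord_in_linear Y n) as [Ia Is]. intros [Ha Hs].
  split; intros; unfold coord_map.
  - rewrite <- Ia, <- Ha. reflexivity.
  - rewrite <- Is, <- Hs. reflexivity.
Qed.

Lemma coord_map_bounded {X Y : Module A} (f : X -> Y) (n : nat) (M : R) :
  is_morphism f -> bounded_by f M -> bounded_by (coord_map f n) M.
Proof.
  intros Hf [HM0 HM]. split; [assumption|]. intros u.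
  rewrite <- norm_coord_val, coord_map_val by assumption. apply HM.
Qed.

(** A preimage in the whole module may be projected to its n-th coordinate without increasing its
    norm. *)
Lemma coord_map_coisometric {X Y : Module A} (f : Y -> X) (n : nat) :
  is_morphism f -> coisometric f -> coisometric (coord_map f n).
Proof.
  intros Hf [H1 Hc]. split; [now apply coord_map_bounded|].
  intros x eps He. destruct (Hc (coord_val x) eps He) as [y [Hy Hn]].
  exists (coord_in Y n y). split.
  - apply coord_val_inj. rewrite coord_map_val by assumption.
    change (f (pn n @v y) = coord_val x).
    now rewrite <- morphism_coord, Hy, coord_val_fixed.
  - apply Rle_lt_trans with (2 := Hn). apply norm_coord_le.
Qed.

(** * Finite type and projective coordinates imply extreme projectivity *)

(** The lift on the n-th coordinate is presented as a map on all of [P], with [r] the norm of the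
    restriction of [phi]. The last clause, that no smaller constant bounds this restriction, feeds
    [near_norming]. *)
Lemma coord_lift {P X Y : Module A} (tau : Y -> X) (phi : P -> X) (n : nat) (delta : R) :
  is_morphism tau -> coisometric tau -> is_morphism phi ->
  ext_proj_Nor (coord_space P n) -> 0 < delta ->
  exists (g : P -> Y) (r : R), is_linear g /\
    (forall x, pn n @v g x = g x) /\ (forall x, g (pn n @v x) = g x) /\
    (forall x, tau (g x) = phi (pn n @v x)) /\
    (forall x, norm (g x) <= (1 + delta) * r * norm (pn n @v x)) /\
    0 <= r /\
    (forall t, 0 <= t < r -> exists u, pn n @v u = u /\ t * norm u < norm (phi u)).
Proof.
  intros Ht Hc Hp HP Hd.
  destruct Hp as [Hl [Ha [M HM]]].
  assert (Hp : is_morphism phi) by (split; [|split]; [assumption..|now exists M]).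
  destruct (opnorm_exists _ _ (coord_map_bounded phi n M Hp HM)) as [r [[[Hr0 Hr] Hmin] _]].
  (* If no such [u] existed, [t] would be a bound smaller than the least one. *)
  assert (Hsharp : forall t, 0 <= t < r ->
            exists u, pn n @v u = u /\ t * norm u < norm (phi u)).
  { intros t [Ht0 Htr]. apply NNPP. intros Hno.
    assert (r <= t); [|lra]. apply Hmin. split; [assumption|]. intros u.
    rewrite <- norm_coord_val, coord_map_val by assumption.
    destruct (Rle_dec (norm (phi (coord_val u))) (t * norm u)) as [|Hu]; [assumption|].
    exfalso. apply Hno. exists (coord_val u). split; [apply coord_val_fixed|].
    now apply Rnot_le_lt. }
  destruct (coord_in_linear P n) as [Ia Is].
  (* The tolerance [delta * r] has to be positive. For r = 0 the restriction of [phi] vanishes and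
     the zero map lifts it within the same multiplicative bound. *)
  destruct (Req_dec r 0) as [E|E].
  - exists (fun _ => ns_zero), r. rewrite E in *.
    split; [split; intros; symmetry; [apply ns_add0|apply scal_zero]|].
    split; [intros; apply coord_zero|]. split; [reflexivity|]. split; [|split; [|split]].
    + intros x. rewrite linear_zero by apply Ht. symmetry. apply ns_norm_eq0.
      apply Rle_antisym; [|apply ns_norm_ge0].
      specialize (Hr (coord_in P n x)).
      rewrite <- norm_coord_val, coord_map_val in Hr by assumption.
      rewrite Rmult_0_l in Hr. exact Hr.
    + intros x. rewrite norm0. lra.
    + lra.
    + assumption.
  - destruct (HP (coord_space X n) (coord_space Y n) (coord_map tau n) (coord_map phi n)
                r (delta * r)) as [psi [[Pa Ps] [Hlift [r' [[[_ Hb] _] Hr']]]]].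
    + apply coord_map_linear, Ht.
    + now apply coord_map_coisometric.
    + now apply coord_map_linear.
    + now split; [split|].
    + nra.
    + exists (fun x => coord_val (psi (coord_in P n x))), r.
      split; [split; intros|split; [|split; [|split; [|split; [|split]]]]].
      * now rewrite Ia, Pa.
      * now rewrite Is, Ps.
      * intros x. apply coord_val_fixed.
      * intros x. do 2 f_equal. apply coord_val_inj, coord_same.
      * intros x. rewrite <- coord_map_val, Hlift, coord_map_val by assumption. reflexivity.
      * intros x. rewrite norm_coord_val. specialize (Hb (coord_in P n x)).
        rewrite <- (norm_coord_val (coord_in P n x)) in Hb.
        change (coord_val (coord_in P n x)) with (pn n @v x) in Hb.
        assert (H0 := ns_norm_ge0 P (pn n @v x)). nra.
      * assumption.
      * assumption.
Qed.

(** A vector at which [phi] exceeds the factor (1 - eta) r is rescaled to norm [s]; for r = 0 the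
    zero vector serves. *)
Lemma near_norming {P X : Module A} (phi : P -> X) (n : nat) (r eta s : R) :
  is_linear phi -> 0 <= r -> 0 < eta < 1 -> 0 <= s ->
  (forall t, 0 <= t < r -> exists u, pn n @v u = u /\ t * norm u < norm (phi u)) ->
  exists z, pn n @v z = z /\ norm z <= s /\ (1 - eta) * r * s <= norm (phi z).
Proof.
  intros Hl Hr Heta Hs H. destruct Hr as [Hr| <-].
  - destruct (H ((1 - eta) * r)) as [u [Hu Hn]]; [nra|].
    assert (Hpos : 0 < norm u).
    { destruct (ns_norm_ge0 P u) as [|E]; [assumption|].
      symmetry in E. apply ns_norm_eq0 in E. rewrite E, (linear_zero phi Hl), !norm0 in Hn.
      lra. }
    assert (Hq : 0 <= s / norm u) by (apply Rle_mult_inv_pos; assumption).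
    exists ((s / norm u, 0) *v u). rewrite coord_scal, Hu.
    destruct Hl as [_ Hs']. rewrite Hs', !ns_normZ, Cabs_real, Rabs_right by lra.
    assert (E : s / norm u * norm u = s) by (field; lra).
    split; [reflexivity|split; [lra|]].
    rewrite <- E at 1. nra.
  - exists ns_zero. rewrite (linear_zero phi Hl), !norm0, coord_zero.
    split; [reflexivity|]. lra.
Qed.

(** Homogeneity of [Y] makes the glued lift unique, hence linear and equivariant, and turns
    coordinatewise domination into the norm bound (1 + delta) r. *)
Theorem finite_type_ext_proj (P : Module A) :
  in_H P -> (forall n, ext_proj_Nor (coord_space P n)) -> finite_type P ->
  ext_proj_wrt (@in_H A) P.
Proof.
  intros [_ HP] Hn Hft X Y tau phi r eps [_ HX] [_ HY] Ht Hc Hp [[Hr0 Hr] _] He.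
  (* Chosen so that delta r < eps; the summand 1 covers r = 0. *)
  set (delta := eps / (2 * (r + 1))).
  assert (Ed : delta * (2 * (r + 1)) = eps) by (unfold delta; field; lra).
  assert (Hd : 0 < delta) by (apply Rdiv_lt_0_compat; lra).
  destruct (choice_fun _ (fun n => coord_lift tau phi n delta Ht Hc Hp (Hn n) Hd)) as [g Hg].
  destruct (choice_fun _ Hg) as [q Hq]. clear Hg.
  (* Finite type leaves only finitely many nonzero [g n x], so they can be glued. *)
  assert (Hex : forall x, exists y, forall n, pn n @v y = g n x).
  { intros x. destruct (Hft x) as [N HN].
    apply glue_coords with N; intros n; destruct (Hq n) as [Hl [Hfix [Hg _]]];
      [apply Hfix|]. intros HnN. rewrite <- Hg, HN by assumption. now apply linear_zero. }
  destruct (choice_fun _ Hex) as [psi Hpsi]. clear Hex.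
  assert (Hlin : is_linear psi).
  { split; intros; apply homogeneous_ext; try assumption; intros n;
      rewrite ?coord_add, ?coord_scal, !Hpsi; apply Hq. }
  assert (Hact : forall a x, sa_mem A a -> psi (a @v x) = a @v psi x).
  { intros a x Ha. apply homogeneous_ext; [assumption|]. intros n.
    rewrite coord_act, !Hpsi by assumption. destruct (Hq n) as [[_ Hs] [_ [Hg _]]].
    rewrite <- (Hg (a @v x)), coord_act, Hs, Hg by assumption. reflexivity. }
  assert (Hb : bounded_by psi ((1 + delta) * r)).
  { split; [nra|]. intros x.
    apply le_of_factor_limit with (1 + delta). intros eta Heta.
    (* [z] has coordinates no larger than those of [x] on which [phi] is almost
       norm-attaining, so a lift [y] of [phi z] dominates [psi x] coordinatewise. *)
    assert (Hz : forall n, exists z, pn n @v z = z /\ norm z <= norm (pn n @v x) /\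
              (1 - eta) * q n * norm (pn n @v x) <= norm (phi z)).
    { intros n. apply near_norming; try assumption; try apply ns_norm_ge0; try apply Hp;
        apply (Hq n). }
    destruct (choice_fun _ Hz) as [zc Hzc]. destruct (Hft x) as [N HN].
    destruct (glue_coords P zc N) as [z Hcoord].
    { intros n. apply Hzc. }
    { intros n HnN. apply ns_norm_eq0, Rle_antisym; [|apply ns_norm_ge0].
      rewrite <- (@norm0 P), <- (HN n HnN). apply Hzc. }
    assert (Hzx : norm z <= norm x) by (apply HP; intros n; rewrite Hcoord; apply Hzc).
    destruct Hc as [[_ Hc1] Hc]. destruct (Hc (phi z) eta) as [y [Hy Hny]]; [lra|].
    (* In coordinate n, with g_n = [g n]: (1 - eta) |g_n x| <= (1 + delta) (1 - eta) q_n |x_n| <= (1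
       + delta) |phi z_n| <= (1 + delta) |y_n|, the last step because [tau] is contractive. *)
    assert (Hdom : norm (((1 - eta), 0) *v psi x) <= norm ((1 + delta, 0) *v y)).
    { apply HY. intros n. rewrite !coord_scal, !ns_normZ, !Cabs_real, !Rabs_right, Hpsi by lra.
      destruct (Hq n) as [_ [_ [_ [_ [Hgn _]]]]]. specialize (Hgn x).
      destruct (Hzc n) as [_ [_ Hzn]].
      specialize (Hc1 (pn n @v y)).
      rewrite <- (morphism_coord tau), Hy, (morphism_coord phi), Hcoord in Hc1 by assumption.
      apply Rmult_le_compat_l with (r := 1 - eta) in Hgn; [|lra].
      apply Rle_trans with (1 := Hgn).
      replace ((1 - eta) * ((1 + delta) * q n * norm (pn n @v x)))
        with ((1 + delta) * ((1 - eta) * q n * norm (pn n @v x))) by ring.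
      apply Rmult_le_compat_l; lra. }
    rewrite !ns_normZ, !Cabs_real, !Rabs_right in Hdom by lra.
    specialize (Hr z). apply Rmult_le_compat_l with (r := r) in Hzx; [|assumption].
    apply Rle_trans with ((1 + delta) * (r * norm x + eta)); [|lra].
    rewrite Rmult_comm. apply Rle_trans with (1 := Hdom).
    apply Rmult_le_compat_l; lra. }
  exists psi. split; [split; [|split]; [assumption..|now eexists; exact Hb]|]. split.
  - intros x. apply homogeneous_ext; [assumption|]. intros n.
    rewrite (morphism_coord tau), (morphism_coord phi), Hpsi by assumption. apply Hq.
  - destruct (opnorm_exists _ _ Hb) as [r' [Hr' Hle]]. exists r'. split; [assumption|]. nra.
Qed.

(** * A normed space concentrated in one coordinate *)

(** The algebra acts through the character sending a to a_n, which is contractive on it. *)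
Definition coord_module (n : nat) (V : NormedSpace) : Module A.
Proof.
  refine {| md_sp := V; md_act := fun a v => a n *v v |}; intros.
  - apply ns_scalDr.
  - apply scal_comm.
  - apply scal_zero.
  - rewrite !opp_scal. apply scal_comm.
  - apply ns_scalDl.
  - symmetry. apply ns_scalA.
  - symmetry. apply ns_scalA.
  - rewrite ns_normZ. apply Rmult_le_compat_r; [apply ns_norm_ge0|now apply Cabs_coord_le].
Defined.

Lemma coord_module_in_H (n : nat) (V : NormedSpace) : in_H (coord_module n V).
Proof.
  assert (E : forall x : coord_module n V, pn n @v x = x).
  { intros x. change (pn n n *v x = x). rewrite pn_same. apply ns_scal1. }
  split.
  - intros x eps He. exists ((C1, pn n, x) :: nil). split.
    + constructor; [apply pn_mem|constructor].
    + change (norm (x +v -v (C1 *v (pn n @v x) +v ns_zero)) < eps).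
      now rewrite E, ns_scal1, ns_add0, ns_addN, norm0.
  - intros x y H. specialize (H n). now rewrite !E in H.
Qed.

(** Composing [phi] with the projection onto X_n gives a morphism of [P] into a module concentrated
    in coordinate n; its lift is then restricted to X_n. *)
Theorem ext_proj_coord (P : Module A) (n : nat) :
  ext_proj_wrt (@in_H A) P -> ext_proj_Nor (coord_space P n).
Proof.
  intros HP X Y tau phi r eps Ht Hc [Pa Ps] [[Hr0 Hr] Hmin] He.
  destruct (coord_in_linear P n) as [Ia Is].
  assert (Hbd : bounded_by (fun p => phi (coord_in P n p)) r).
  { split; [assumption|]. intros p.
    apply Rle_trans with (1 := Hr _). apply Rmult_le_compat_l; [assumption|].
    apply norm_coord_le. }
  destruct (HP (coord_module n X) (coord_module n Y) tau
              (fun p => phi (coord_in P n p)) r eps)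
    as [psi [[[Fa Fs] _] [Hlift [r' [[[Hr'0 Hr'] _] Hlt]]]]]; try assumption.
  - apply coord_module_in_H.
  - apply coord_module_in_H.
  - split; [assumption|split]; [|now exists 1; apply Hc].
    intros a x _. apply Ht.
  - split; [split; intros|split; [|now exists r]].
    + now rewrite Ia, Pa.
    + now rewrite Is, Ps.
    + intros a x Ha. change (phi (coord_in P n (a @v x)) = a n *v phi (coord_in P n x)).
      rewrite <- Ps. f_equal. apply coord_val_inj. now apply coord_act.
  (* Every vector of X_n is its own projection, so a bound for the composite also bounds [phi] and
     the operator norm stays [r]. *)
  - split; [assumption|]. intros M [HM0 HM]. apply Hmin. split; [assumption|].
    intros u. rewrite <- (coord_in_val u) at 1. apply HM.
  - assert (Hb : bounded_by (fun u : coord_space P n => psi (coord_val u) : Y) r').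
    { split; [assumption|]. intros u. apply Hr'. }
    exists (fun u => psi (coord_val u)). split; [|split].
    + split; intros; [apply Fa|apply Fs].
    + intros u. rewrite Hlift. now rewrite coord_in_val.
    + destruct (opnorm_exists _ _ Hb) as [r'' [H1 H2]]. exists r''. split; [assumption|lra].
Qed.

(** * Modules of null sequences *)

(* In [f n k] only [n] is a coordinate: the algebra acts through it, and the
   convergence to zero is as [n] grows, uniformly in [k]. *)
Definition c0_mem {V : NormedSpace} (f : nat -> nat -> V) : Prop :=
  (exists M, forall n k, norm (f n k) <= M) /\
  (forall eps, 0 < eps -> exists N, forall n k, (N <= n)%nat -> norm (f n k) <= eps).

(** The scalar may vary with n, which covers both scalar multiplication and the action of the
    algebra. *)
Record stable {V : NormedSpace} (Q : (nat -> nat -> V) -> Prop) : Prop := {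
  stable_zero : Q (fun _ _ => ns_zero);
  stable_add : forall f g, Q f -> Q g -> Q (fun n k => f n k +v g n k);
  stable_scal : forall (c : nat -> C) f, Q f -> Q (fun n k => c n *v f n k)
}.

Lemma c0_mem_zero {V : NormedSpace} : c0_mem (fun _ _ => @ns_zero V).
Proof.
  split; [exists 0|intros eps He; exists 0%nat]; intros; rewrite norm0; lra.
Qed.

Lemma c0_mem_add {V : NormedSpace} (f g : nat -> nat -> V) :
  c0_mem f -> c0_mem g -> c0_mem (fun n k => f n k +v g n k).
Proof.
  intros [[M HM] Hf] [[M' HM'] Hg]. split.
  - exists (M + M'). intros n k. assert (H := ns_norm_tri V (f n k) (g n k)).
    specialize (HM n k). specialize (HM' n k). lra.
  - intros eps He. destruct (Hf (eps / 2)) as [N HN]; [lra|].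
    destruct (Hg (eps / 2)) as [N' HN']; [lra|]. exists (N + N')%nat. intros n k Hn.
    assert (H := ns_norm_tri V (f n k) (g n k)).
    specialize (HN n k ltac:(lia)). specialize (HN' n k ltac:(lia)). lra.
Qed.

Lemma c0_mem_scal {V : NormedSpace} (c : nat -> C) (f : nat -> nat -> V) (B : R) :
  (forall n, Cabs (c n) <= B) -> c0_mem f -> c0_mem (fun n k => c n *v f n k).
Proof.
  intros HB [[M HM] Hf].
  assert (HB0 : 0 <= B) by (apply Rle_trans with (2 := HB 0%nat); apply Cabs_ge0).
  split.
  - exists (B * M). intros n k. rewrite ns_normZ.
    apply Rmult_le_compat; [apply Cabs_ge0|apply ns_norm_ge0|apply HB|apply HM].
  - intros eps He. destruct (Hf (eps / (B + 1))) as [N HN]; [apply Rdiv_lt_0_compat; lra|].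
    exists N. intros n k Hn. rewrite ns_normZ.
    apply Rle_trans with (B * (eps / (B + 1))).
    + apply Rmult_le_compat; [apply Cabs_ge0|apply ns_norm_ge0|apply HB|now apply HN].
    + assert (E : eps / (B + 1) * (B + 1) = eps) by (field; lra).
      assert (H : 0 < eps / (B + 1)) by (apply Rdiv_lt_0_compat; lra). lra.
Qed.

Definition c0_norms {V : NormedSpace} (f : nat -> nat -> V) (t : R) : Prop :=
  exists n k, t = norm (f n k).

Lemma c0_norms_bound {V : NormedSpace} (f : nat -> nat -> V) : c0_mem f -> bound (c0_norms f).
Proof. intros [[M HM] _]. exists M. intros t [n [k ->]]. apply HM. Qed.

Definition c0_norm {V : NormedSpace} (f : nat -> nat -> V) (Hf : c0_mem f) : R :=
  proj1_sig (completeness (c0_norms f) (c0_norms_bound f Hf)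
    (ex_intro _ _ (ex_intro _ 0%nat (ex_intro _ 0%nat eq_refl)))).

Lemma c0_norm_ub {V : NormedSpace} (f : nat -> nat -> V) (Hf : c0_mem f) (n k : nat) :
  norm (f n k) <= c0_norm f Hf.
Proof.
  unfold c0_norm. destruct (completeness _ _ _) as [m [Hub Hl]].
  apply Hub. now exists n, k.
Qed.

Lemma c0_norm_least {V : NormedSpace} (f : nat -> nat -> V) (Hf : c0_mem f) (B : R) :
  (forall n k, norm (f n k) <= B) -> c0_norm f Hf <= B.
Proof.
  intros H. unfold c0_norm. destruct (completeness _ _ _) as [m [Hub Hl]].
  apply Hl. intros t [n [k ->]]. apply H.
Qed.

Definition c0_car {V : NormedSpace} (Q : (nat -> nat -> V) -> Prop) : Type :=
  {f : nat -> nat -> V | c0_mem f /\ Q f}.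

Definition c0_val {V : NormedSpace} {Q : (nat -> nat -> V) -> Prop} (u : c0_car Q) :
  nat -> nat -> V := proj1_sig u.

Lemma c0_ext {V : NormedSpace} {Q : (nat -> nat -> V) -> Prop} (u v : c0_car Q) :
  (forall n k, c0_val u n k = c0_val v n k) -> u = v.
Proof.
  destruct u as [u hu], v as [v hv]. intros H.
  assert (E : u = v).
  { apply functional_extensionality; intros n.
    apply functional_extensionality; intros k. apply H. }
  subst v. f_equal. apply ProofIrrelevance.proof_irrelevance.
Qed.

Section NullSequences.
Context {V : NormedSpace} (Q : (nat -> nat -> V) -> Prop) (HQ : stable Q).

Definition c0_zero : c0_car Q :=
  exist _ (fun _ _ => ns_zero) (conj c0_mem_zero (stable_zero Q HQ)).

Definition c0_add (u v : c0_car Q) : c0_car Q :=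
  exist _ (fun n k => c0_val u n k +v c0_val v n k)
    (conj (c0_mem_add _ _ (proj1 (proj2_sig u)) (proj1 (proj2_sig v)))
          (stable_add Q HQ _ _ (proj2 (proj2_sig u)) (proj2 (proj2_sig v)))).

(** One operation for both scalars (constant [c]) and the algebra action; [B] keeps the product
    bounded and null. *)
Definition c0_mult (c : nat -> C) (B : R) (HB : forall n, Cabs (c n) <= B) (u : c0_car Q) :
  c0_car Q :=
  exist _ (fun n k => c n *v c0_val u n k)
    (conj (c0_mem_scal _ _ B HB (proj1 (proj2_sig u)))
          (stable_scal Q HQ c _ (proj2 (proj2_sig u)))).

Definition c0_scal (c : C) : c0_car Q -> c0_car Q :=
  c0_mult (fun _ => c) (Cabs c) (fun _ => Rle_refl _).

Definition c0_sup (u : c0_car Q) : R := c0_norm (c0_val u) (proj1 (proj2_sig u)).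

Definition c0_space : NormedSpace.
Proof.
  refine {| ns_car := c0_car Q; ns_zero := c0_zero; ns_add := c0_add;
            ns_opp := c0_scal (-1, 0); ns_scal := c0_scal; ns_norm := c0_sup |};
  intros; try (apply c0_ext; intros n k; simpl).
  - apply ns_addA.
  - apply ns_addC.
  - apply ns_add0.
  - rewrite <- opp_scal. apply ns_addN.
  - apply ns_scal1.
  - apply ns_scalA.
  - apply ns_scalDr.
  - apply ns_scalDl.
  - apply Rle_trans with (2 := c0_norm_ub _ _ 0%nat 0%nat). apply ns_norm_ge0.
  - apply ns_norm_eq0, Rle_antisym; [|apply ns_norm_ge0]. rewrite <- H. apply c0_norm_ub.
  - apply c0_norm_least. intros n k. apply Rle_trans with (1 := ns_norm_tri _ _ _).
    apply Rplus_le_compat; apply c0_norm_ub.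
  - apply Rle_antisym.
    + apply c0_norm_least. intros n k. simpl. rewrite ns_normZ.
      apply Rmult_le_compat_l; [apply Cabs_ge0|apply c0_norm_ub].
    (* The reverse inequality divides by |c|, so |c| = 0 is treated apart. *)
    + destruct (Cabs_ge0 c) as [Hc|Hc].
      * apply Rmult_le_reg_l with (/ Cabs c); [now apply Rinv_0_lt_compat|].
        rewrite <- Rmult_assoc, Rinv_l, Rmult_1_l by lra.
        apply c0_norm_least. intros n k.
        apply Rmult_le_reg_l with (Cabs c); [assumption|].
        rewrite <- Rmult_assoc, Rinv_r, Rmult_1_l by lra. rewrite <- ns_normZ.
        apply (c0_norm_ub (c0_val (c0_scal c x))).
      * rewrite <- Hc, Rmult_0_l.
        apply Rle_trans with (2 := c0_norm_ub _ _ 0%nat 0%nat). apply ns_norm_ge0.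
Defined.

(* [md_act] is total on sequences; outside the algebra multiplication by [a] could
   leave the null sequences, so it is replaced by zero there. *)
Definition mem_coef (a : cseq) (n : nat) : C :=
  if excluded_middle_informative (sa_mem A a) then a n else C0.

Lemma mem_coefE (a : cseq) (n : nat) : sa_mem A a -> mem_coef a n = a n.
Proof. intros H. unfold mem_coef. now destruct (excluded_middle_informative _). Qed.

(** The absolute value makes the bound valid for every sequence, since [sa_norm] may be negative
    outside the algebra. *)
Lemma mem_coef_bounded (a : cseq) (n : nat) : Cabs (mem_coef a n) <= Rabs (sa_norm A a).
Proof.
  unfold mem_coef. destruct (excluded_middle_informative _) as [H|H].
  - apply Rle_trans with (2 := Rle_abs _). now apply Cabs_coord_le.
  - rewrite Cabs_C0. apply Rabs_pos.
Qed.

Definition c0_module : Module A.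
Proof.
  refine {| md_sp := c0_space;
            md_act := fun a => c0_mult (mem_coef a) _ (mem_coef_bounded a) |};
  intros; try (apply c0_ext; intros n k; simpl).
  - apply ns_scalDr.
  - apply scal_comm.
  - apply scal_zero.
  - apply scal_comm.
  - rewrite !mem_coefE by (try apply sa_mem_add; assumption). apply ns_scalDl.
  - rewrite !mem_coefE by (try apply sa_mem_scal; assumption). symmetry. apply ns_scalA.
  - rewrite !mem_coefE by (try apply sa_mem_mul; assumption). symmetry. apply ns_scalA.
  - apply c0_norm_least. intros n k. simpl. rewrite ns_normZ, mem_coefE by assumption.
    apply Rmult_le_compat; [apply Cabs_ge0|apply ns_norm_ge0|now apply Cabs_coord_le|].
    apply c0_norm_ub.
Defined.

Definition c0_at (u : c0_module) (n k : nat) : V := c0_val u n k.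

Lemma c0_at_ext (u v : c0_module) : (forall n k, c0_at u n k = c0_at v n k) -> u = v.
Proof. apply c0_ext. Qed.

Lemma c0_at_add (u v : c0_module) (n k : nat) : c0_at (u +v v) n k = c0_at u n k +v c0_at v n k.
Proof. reflexivity. Qed.

Lemma c0_at_scal (c : C) (u : c0_module) (n k : nat) : c0_at (c *v u) n k = c *v c0_at u n k.
Proof. reflexivity. Qed.

Lemma c0_at_act (a : cseq) (u : c0_module) (n k : nat) :
  sa_mem A a -> c0_at (a @v u) n k = a n *v c0_at u n k.
Proof. intros Ha. rewrite <- (mem_coefE a n Ha). reflexivity. Qed.

Lemma norm_c0_at_le (u : c0_module) (n k : nat) : norm (c0_at u n k) <= norm u.
Proof. exact (c0_norm_ub (c0_val u) (proj1 (proj2_sig u)) n k). Qed.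

Lemma norm_c0_le (u : c0_module) (B : R) : (forall n k, norm (c0_at u n k) <= B) -> norm u <= B.
Proof. exact (c0_norm_least (c0_val u) (proj1 (proj2_sig u)) B). Qed.

Lemma c0_module_in_H : in_H c0_module.
Proof.
  split.
  - intros u eps He.
    destruct (proj2 (proj1 (proj2_sig u)) (eps / 2)) as [N HN]; [lra|].
    (* Acting by this finite sequence truncates [u] at [N], and the remaining tail is uniformly
       small. *)
    set (a := fun n => if Nat.ltb n N then C1 else C0).
    assert (Ha : sa_mem A a).
    { apply sa_mem_c00. exists N. intros n Hn. unfold a.
      now apply Nat.ltb_ge in Hn as ->. }
    exists ((C1, a, u) :: nil). split; [now constructor|].
    apply Rle_lt_trans with (eps / 2); [|lra]. apply norm_c0_le. intros n k.
    change (norm (c0_at (u +v -v (C1 *v (a @v u) +v ns_zero)) n k) <= eps / 2).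
    rewrite ns_scal1, ns_add0, opp_scal, c0_at_add, c0_at_scal, c0_at_act by assumption.
    rewrite <- opp_scal. unfold a. destruct (Nat.ltb_spec n N) as [Hn|Hn].
    + rewrite ns_scal1, ns_addN, norm0. lra.
    + rewrite scal0, opp_scal, scal_zero, ns_add0. now apply HN.
  (* The norm of [u] is the supremum of the norms of its coordinates. *)
  - intros u v H. apply norm_c0_le. intros n k.
    apply Rle_trans with (norm (pn n @v u)).
    + rewrite <- (ns_scal1 _ (c0_at u n k)), <- (pn_same n), <- c0_at_act by apply pn_mem.
      apply norm_c0_at_le.
    + apply Rle_trans with (1 := H n). apply norm_coord_le.
Qed.

End NullSequences.

Arguments c0_at {V Q HQ} u n k.

Definition c0_mk {V : NormedSpace} (Q : (nat -> nat -> V) -> Prop) (HQ : stable Q)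
  (f : nat -> nat -> V) (Hf : c0_mem f) (Hq : Q f) : c0_module Q HQ :=
  exist _ f (conj Hf Hq).

(** * Topological projectivity implies finite type *)

(** Bounding w_n^2 s_n instead of w_n s_n makes w_n s_n tend to 0, being at most eps / w_n for w_n >
    0. *)
Lemma slow_weight (s : nat -> R) (eps : R) :
  (forall n, 0 <= s n) -> 0 < eps ->
  (forall e, 0 < e -> exists N, forall n, (N <= n)%nat -> s n <= e) ->
  exists w : nat -> nat,
    (forall k, exists N, forall n, (N <= n)%nat -> (k <= w n)%nat) /\
    (forall n, INR (w n) * INR (w n) * s n <= eps).
Proof.
  intros Hs He Hlim.
  assert (Hmax : forall n b, exists k, INR k * INR k * s n <= eps /\
            forall j, (j <= b)%nat -> INR j * INR j * s n <= eps -> (j <= k)%nat).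
  { intros n b. induction b as [|b [k [Hk Hmax]]].
    - exists 0%nat. simpl. split; [lra|]. intros; lia.
    - destruct (Rle_dec (INR (S b) * INR (S b) * s n) eps) as [Hb|Hb].
      + exists (S b). split; [assumption|]. intros; lia.
      + exists k. split; [assumption|]. intros j Hj Hjs.
        destruct (Nat.eq_dec j (S b)) as [->|]; [contradiction|].
        apply Hmax; [lia|assumption]. }
  (* The search bound is [n] itself: a maximum exists even when s_n = 0, and any fixed k is
     eventually within reach. *)
  destruct (choice_fun _ (fun n => Hmax n n)) as [w Hw]. exists w.
  split; [|intros n; apply Hw].
  intros k. assert (Hk := pos_INR k).
  destruct (Hlim (eps / (INR k * INR k + 1))) as [N HN]; [apply Rdiv_lt_0_compat; nra|].
  exists (N + k)%nat. intros n Hn. apply Hw; [lia|].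
  specialize (HN n ltac:(lia)).
  assert (E : eps / (INR k * INR k + 1) * (INR k * INR k + 1) = eps) by (field; nra).
  assert (Hd : 0 < eps / (INR k * INR k + 1)) by (apply Rdiv_lt_0_compat; nra).
  apply Rmult_le_compat_l with (r := INR k * INR k) in HN; nra.
Qed.

(** This encodes the null sequences c_0(V) as families, so that one construction yields both
    modules. *)
Definition row_constant {V : NormedSpace} (f : nat -> nat -> V) : Prop :=
  forall n k, f n k = f n 0%nat.

(** The shift in k + 1 makes the condition trivial for k = 0, leaving the first column free. *)
Definition eventually_weighted {V : NormedSpace} (f : nat -> nat -> V) : Prop :=
  forall k, exists N, forall n, (N <= n)%nat -> f n k = (INR k + 1, 0) *v f n 0%nat.

Lemma row_constant_stable {V : NormedSpace} : stable (@row_constant V).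
Proof.
  split.
  - intros n k. reflexivity.
  - intros f g Hf Hg n k. now rewrite Hf, Hg.
  - intros c f Hf n k. now rewrite Hf.
Qed.

Lemma eventually_weighted_stable {V : NormedSpace} : stable (@eventually_weighted V).
Proof.
  split.
  - intros k. exists 0%nat. intros n _. symmetry. apply scal_zero.
  - intros f g Hf Hg k. destruct (Hf k) as [N HN]. destruct (Hg k) as [M HM].
    exists (N + M)%nat. intros n Hn. rewrite HN, HM by lia. symmetry. apply ns_scalDr.
  - intros c f Hf k. destruct (Hf k) as [N HN]. exists N. intros n Hn.
    rewrite HN by assumption. apply scal_comm.
Qed.

Definition const_rows (V : NormedSpace) : Module A :=
  c0_module (@row_constant V) row_constant_stable.

Definition weighted_rows (V : NormedSpace) : Module A :=
  c0_module (@eventually_weighted V) eventually_weighted_stable.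

Lemma c0_at_mem {V : NormedSpace} {Q : (nat -> nat -> V) -> Prop} {HQ : stable Q}
  (u : c0_module Q HQ) : c0_mem (c0_at u).
Proof. exact (proj1 (proj2_sig u)). Qed.

Lemma c0_mem_first {V : NormedSpace} (f : nat -> nat -> V) :
  c0_mem f -> c0_mem (fun n _ => f n 0%nat).
Proof.
  intros [[M HM] Hf]. split; [exists M; intros; apply HM|].
  intros eps He. destruct (Hf eps He) as [N HN]. exists N. intros n k Hn. now apply HN.
Qed.

Definition first_column (V : NormedSpace) (u : weighted_rows V) : const_rows V :=
  c0_mk row_constant row_constant_stable (fun n _ => c0_at u n 0%nat)
    (c0_mem_first _ (c0_at_mem u)) (fun n k => eq_refl).

Lemma first_column_morphism (V : NormedSpace) :
  is_morphism (first_column V) /\ coisometric (first_column V).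
Proof.
  assert (Hb : bounded_by (first_column V) 1).
  { split; [lra|]. intros u. rewrite Rmult_1_l. apply norm_c0_le. intros n k.
    exact (norm_c0_at_le _ _ u n 0%nat). }
  split; [split; [split|split]|split].
  - intros; apply c0_at_ext; reflexivity.
  - intros; apply c0_at_ext; reflexivity.
  - intros; apply c0_at_ext; reflexivity.
  - now exists 1.
  - assumption.
  - intros x eps He. set (xs := fun n => c0_at x n 0%nat).
    destruct (c0_at_mem x) as [_ Hv].
    destruct (slow_weight (fun n => norm (xs n)) (eps / 2)) as [w [Hw Hws]].
    { intros n. apply ns_norm_ge0. }
    { lra. }
    { intros e Hpos. destruct (Hv e Hpos) as [N HN]. exists N. intros n Hn. now apply HN. }
    set (y := fun n k => if Nat.leb k (w n) then (INR k + 1, 0) *v xs n else ns_zero).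
    assert (Hny : forall n k, norm (y n k) <= INR (w n) * norm (xs n) + norm (xs n)).
    { intros n k. assert (H0 := ns_norm_ge0 V (xs n)). assert (Hk := pos_INR k).
      assert (Hwn := pos_INR (w n)). unfold y. destruct (Nat.leb_spec k (w n)) as [Hkw|_].
      - rewrite ns_normZ, Cabs_real, Rabs_right by lra. apply le_INR in Hkw. nra.
      - rewrite norm0. nra. }
    (* For natural numbers w_n <= w_n^2, so the weights add at most eps / 2 to the norm. *)
    assert (Hwx : forall n, INR (w n) * norm (xs n) <= eps / 2).
    { intros n. assert (H0 := ns_norm_ge0 V (xs n)). specialize (Hws n).
      destruct (w n) as [|m]; [simpl; lra|]. rewrite S_INR in *.
      assert (Hm := pos_INR m). assert (0 <= INR m * norm (xs n)) by nra. nra. }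
    assert (Hxs : forall n, norm (xs n) <= norm x) by (intros n; apply norm_c0_at_le).
    assert (Hmem : c0_mem y).
    { split.
      - exists (eps / 2 + norm x). intros n k. specialize (Hny n k). specialize (Hwx n).
        specialize (Hxs n). lra.
      (* The tail is split into |x_n| <= e / 2 and w_n |x_n| <= (eps / 2) / w_n, which is at most e
         / 2 once w_n exceeds eps / e. *)
      - intros e Hpos. destruct (Hv (e / 2)) as [N HN]; [lra|].
        destruct (INR_unbounded (eps / e)) as [K HK].
        destruct (Hw K) as [N' HN']. exists (N + N')%nat. intros n k Hn.
        apply Rle_trans with (1 := Hny n k).
        assert (norm (xs n) <= e / 2) by (apply HN; lia).
        assert (H1 : (K <= w n)%nat) by (apply HN'; lia). apply le_INR in H1.
        assert (E : eps / e * e = eps) by (field; lra).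
        assert (Hpe : 0 < eps / e) by (apply Rdiv_lt_0_compat; lra).
        assert (INR (w n) * norm (xs n) <= e / 2); [|lra].
        apply Rmult_le_reg_l with (INR (w n)); [lra|].
        specialize (Hws n). simpl in Hws. rewrite <- Rmult_assoc.
        apply Rle_trans with (1 := Hws). nra. }
    assert (Hy0 : forall n, y n 0%nat = xs n).
    { intros n. unfold y. simpl. rewrite Rplus_0_l. apply ns_scal1. }
    assert (Hq : eventually_weighted y).
    { intros k. destruct (Hw k) as [N HN]. exists N. intros n Hn. rewrite Hy0. unfold y.
      specialize (HN n Hn). apply Nat.leb_le in HN. now rewrite HN. }
    exists (c0_mk eventually_weighted eventually_weighted_stable y Hmem Hq). split.
    + apply c0_at_ext. intros n k. change (y n 0%nat = c0_at x n k). rewrite Hy0.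
      symmetry. exact (proj2 (proj2_sig x) n k).
    + apply Rle_lt_trans with (norm x + eps / 2); [|lra].
      apply norm_c0_le. intros n k. change (norm (y n k) <= norm x + eps / 2).
      specialize (Hny n k). specialize (Hwx n). specialize (Hxs n). lra.
Qed.

Theorem top_proj_finite_type (P : Module A) :
  in_H P -> top_proj_wrt (@in_H A) P -> finite_type P.
Proof.
  intros [Hess _] HP.
  assert (Hmem : forall x : P, c0_mem (fun n _ : nat => pn n @v x)).
  { intros x. split; [exists (norm x); intros; apply norm_coord_le|].
    intros eps He. destruct (essential_vanishing P Hess x eps He) as [N HN].
    exists N. intros n _. apply HN. }
  set (phi := fun x : P => c0_mk row_constant row_constant_stable
                (fun n _ => pn n @v x) (Hmem x) (fun n k => eq_refl)).
  destruct (first_column_morphism P) as [Ht Hc].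
  destruct (HP (const_rows P) (weighted_rows P) (first_column P) phi)
    as [psi [Hpsi Hlift]]; try assumption; try apply c0_module_in_H.
  - split; [split|split].
    + intros x y. apply c0_at_ext. intros n k. apply coord_add.
    + intros c x. apply c0_at_ext. intros n k. apply coord_scal.
    + intros a x Ha. apply c0_at_ext. intros n k.
      transitivity (a n *v (pn n @v x)); [now apply coord_act|].
      symmetry. exact (c0_at_act _ _ a (phi x) n k Ha).
    + exists 1. split; [lra|]. intros x. rewrite Rmult_1_l. apply norm_c0_le. intros n k.
      apply norm_coord_le.
  - intros x.
    assert (Hp := Hpsi). destruct Hp as [_ [_ [M [HM0 HM]]]].
    (* The column [k] is fixed by [M] before [x] enters the estimate; only the threshold [N] depends
       on [x]. *)
    destruct (INR_unbounded M) as [k Hk].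
    destruct (proj2 (proj2_sig (psi x)) k) as [N HN]. exists N. intros n Hn.
    specialize (HN n Hn).
    change (c0_at (psi x) n k = (INR k + 1, 0) *v c0_at (psi x) n 0%nat) in HN.
    assert (H0 : c0_at (psi x) n 0%nat = pn n @v x).
    { change (c0_at (first_column P (psi x)) n 0%nat = pn n @v x). now rewrite Hlift. }
    (* By equivariance the n-th coordinate of psi x is psi (x_n), whose norm dominates the entry in
       every column. *)
    assert (Hle : norm (c0_at (psi x) n k) <= M * norm (pn n @v x)).
    { apply Rle_trans with (2 := HM (pn n @v x)).
      rewrite <- (morphism_coord psi) by assumption.
      rewrite <- (ns_scal1 _ (c0_at (psi x) n k)), <- (pn_same n), <- c0_at_act
        by apply pn_mem.
      apply norm_c0_at_le. }
    rewrite HN, H0, ns_normZ, Cabs_real, Rabs_right in Hle by lra.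
    apply ns_norm_eq0, Rle_antisym; [|apply ns_norm_ge0]. nra.
Qed.

(** A bounded [phi] has an operator norm, and any positive tolerance, here 1, yields a bounded
    lift. *)
Lemma ext_proj_top_proj (K : Module A -> Prop) (P : Module A) :
  ext_proj_wrt K P -> top_proj_wrt K P.
Proof.
  intros H X Y tau phi HX HY Ht Hc Hp.
  assert (Hp' := Hp). destruct Hp' as [_ [_ [M HM]]].
  destruct (opnorm_exists _ _ HM) as [r [Hr _]].
  destruct (H X Y tau phi r 1 HX HY Ht Hc Hp Hr Rlt_0_1) as [psi [H1 [H2 _]]].
  now exists psi.
Qed.

End Coordinates.

Theorem theoremI (A : SeqAlg) (X : Module A) (HX : in_H X) :
  (ext_proj_wrt (@in_H A) X <->
     ((forall n : nat, ext_proj_Nor (coord_space X n)) /\ finite_type X)) /\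
  (top_proj_wrt (@in_H A) X -> finite_type X).
Proof.
  split; [split|].
  - intros H. split.
    + intros n. now apply ext_proj_coord.
    + apply top_proj_finite_type; [assumption|]. now apply ext_proj_top_proj.
  - intros [Hn Hf]. now apply finite_type_ext_proj.
  - now apply top_proj_finite_type.
Qed.
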